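(* Let $\mathcal{N}$ be a continuous nest on a separable Hilbert space $\mathcal{H}$. Let $\Omega$ and $\Psi$ be two stable nets of intervals on $\mathcal{N}$, associated with the stable ideals $\mathcal{I}$ and $\mathcal{J}$ of $\operatorname{Alg}\mathcal{N}$ respectively, i.e. $$\mathcal{I} = \Big\{ X\in\operatorname{Alg}\mathcal{N} : \lim_{P\in\Omega} \sup_{E\in P} \|EXE\|_{\mathrm{ess}} = 0 \Big\},\qquad \mathcal{J} = \Big\{ X\in\operatorname{Alg}\mathcal{N} : \lim_{Q\in\Psi} \sup_{E\in Q} \|EXE\|_{\mathrm{ess}} = 0 \Big\}.$$ Then $$\Omega+\Psi := \{P\cup Q : P\in\Omega,\ Q\in\Psi\}$$ is a stable net and $\mathcal{I}\cap\mathcal{J}$ is its kernel, i.e. $$\mathcal{I}\cap\mathcal{J} = \Big\{ X\in\operatorname{Alg}\mathcal{N} : \lim_{R\in\Omega+\Psi}\ \sup_{E\in R} \|EXE\|_{\mathrm{ess}} = 0 \Big\}.$$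
   Context: A nest $\mathcal{N}$ is a strongly closed chain of orthogonal projections on $\mathcal{H}$ containing $0$ and $I$; it is continuous if it has no atoms (equivalently, it is order isomorphic to $[0,1]$). $\operatorname{Alg}\mathcal{N}$ is the algebra of all bounded operators $X$ on $\mathcal{H}$ with $XN=NXN$ for all $N\in\mathcal{N}$. $\|X\|_{\mathrm{ess}}$ is the essential norm, i.e. the distance from $X$ to the compact operators on $\mathcal{H}$. A stable ideal of $\operatorname{Alg}\mathcal{N}$ is a norm-closed two-sided ideal that is invariant under every (algebra) automorphism of $\operatorname{Alg}\mathcal{N}$. An interval of $\mathcal{N}$ is a projection $N-M$ with $M\le N$ in $\mathcal{N}$. If $P_1,P_2$ are families (sets) of intervals, $P_1$ refines $P_2$, written $P_1\ge P_2$, if for every $E\in P_1$ there is $F\in P_2$ with $E\le F$. A net of intervals is a set $\Omega$ of families of intervals that is directed under refinement. An order isomorphism $\theta:\mathcal{N}\to\mathcal{N}$ acts on intervals by $\theta(N-M)=\theta(N)-\theta(M)$ and on families by $\theta(P)=\{\theta(E):E\in P\}$. The net $\Omega$ is a stable net if $\theta(P)\in\Omega$ for every $P\in\Omega$ and every order isomorphism $\theta$ of $\mathcal{N}$ onto itself. For fixed $X$, the map $P\mapsto\sup_{E\in P}\|EXE\|_{\mathrm{ess}}$ is decreasing with respect to refinement (with $\sup\emptyset=0$), so the limit over a net exists. *)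

(* Defs.v *)
From HB Require Import structures.
From mathcomp Require Import all_boot all_order all_algebra.
From mathcomp Require Import complex.
From mathcomp Require Import all_classical all_reals all_analysis.

Set Implicit Arguments.
Unset Strict Implicit.
Unset Printing Implicit Defensive.

Import Order.TTheory GRing.Theory Num.Theory.
Import numFieldNormedType.Exports.

Local Open Scope classical_set_scope.
Local Open Scope ring_scope.

(* A complex Hilbert space is a complete normed space over R[i] together with
   an inner product, linear in its first argument, that induces the norm. *)
Definition induces_norm (R : realType) (H : completeNormedModType R[i])
    (ip : {dot H for Num.conj}) : Prop :=
  forall x : H, ip x x = `|x| ^+ 2.

Definition separable_space (T : topologicalType) : Prop :=
  exists D : set T, countable D /\ dense D.

Section Operators.
Context {R : realType} {H : completeNormedModType R[i]}.
Implicit Types (X Y T K : H -> H).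

(* The norm of H takes its values in R[i]; hnorm is the same number in R. *)
Definition hnorm (x : H) : R := complex.Re `|x|.

Definition bounded_op X : Prop :=
  linear X /\ exists M : R, forall x, hnorm (X x) <= M * hnorm x.

Definition opnorm X : R :=
  sup [set hnorm (X x) | x in [set x : H | hnorm x <= 1]].

Definition compact_op : set (H -> H) :=
  [set K | bounded_op K /\
     compact (closure (K @` [set x : H | hnorm x <= 1]))].

Definition ess_norm X : R := inf [set opnorm (X \- K) | K in compact_op].

(* {ptws H -> H} carries the topology of pointwise convergence, which induces
   the strong operator topology on the bounded operators. *)
Definition strongly_closed (N : set (H -> H)) : Prop :=
  forall T, bounded_op T -> closure (N : set {ptws H -> H}) T -> N T.

End Operators.

Section Nests.
Context {R : realType} {H : completeNormedModType R[i]}.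
Context (ip : {dot H for Num.conj}).
Implicit Types (X Y A E F L M : H -> H) (N P Q : set (H -> H)).
Implicit Types (Omega Psi : set (set (H -> H))).

(* On R[i], x <= y means that y - x is a nonnegative real. *)
Definition op_le X Y : Prop := forall x : H, ip (X x) x <= ip (Y x) x.

Definition orth_proj L : Prop :=
  [/\ bounded_op L, L \o L = L & forall x y, ip (L x) y = ip x (L y)].

Definition is_nest N : Prop :=
  [/\ forall L, N L -> orth_proj L,
      forall M L, N M -> N L -> op_le M L \/ op_le L M,
      strongly_closed N,
      N (fun=> 0) & N id].

Definition interval N : set (H -> H) :=
  [set E | exists M L, [/\ N M, N L, op_le M L & E = L \- M]].

(* An atom is a minimal nonzero interval, that is, a gap of the chain. *)
Definition atom N : set (H -> H) :=
  [set E | exists M L, [/\ N M, N L, op_le M L, M <> L & E = L \- M /\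
     forall A, N A -> op_le M A -> op_le A L -> A = M \/ A = L]].

Definition continuous_nest N : Prop := is_nest N /\ atom N = set0.

Definition nest_alg N : set (H -> H) :=
  [set X | bounded_op X /\ forall L, N L -> X \o L = L \o X \o L].

Definition refines P1 P2 : Prop :=
  forall E, P1 E -> exists2 F, P2 F & op_le E F.

Definition interval_net N Omega : Prop :=
  [/\ Omega !=set0,
      forall P, Omega P -> P `<=` interval N &
      forall P1 P2, Omega P1 -> Omega P2 ->
        exists P, [/\ Omega P, refines P P1 & refines P P2]].

(* Only the values of theta on N matter. *)
Definition order_iso N (theta : (H -> H) -> (H -> H)) : Prop :=
  set_bij N N theta /\
  forall M L, N M -> N L -> (op_le M L <-> op_le (theta M) (theta L)).

(* The endpoints of a nonzero interval of a nest are unique, so theta acts on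
   intervals by L - M |-> theta L - theta M. *)
Definition iso_image N (theta : (H -> H) -> (H -> H)) P : set (H -> H) :=
  [set E | exists M L, [/\ N M, N L, op_le M L, P (L \- M) &
     E = theta L \- theta M]].

Definition stable_net N Omega : Prop :=
  interval_net N Omega /\
  forall theta P, order_iso N theta -> Omega P -> Omega (iso_image N theta P).

(* Convergence along this filter is convergence of the net indexed by Omega,
   directed by refinement. *)
Definition net_filter Omega : set_system (set (H -> H)) :=
  filter_from Omega (fun P0 => [set P | Omega P /\ refines P P0]).

(* sup set0 = 0 in R, as required for the empty family. *)
Definition sup_ess X P : R := sup [set ess_norm (E \o X \o E) | E in P].

Definition net_kernel N Omega : set (H -> H) :=
  [set X | nest_alg N X /\ sup_ess X @ net_filter Omega --> (0 : R)].

Definition net_add Omega Psi : set (set (H -> H)) :=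
  [set P `|` Q | P in Omega & Q in Psi].

End Nests.

(* Main.v *)
(* For intervals [E <= F] we have [E X E = E (F X F) E], so [sup_ess X] decreases
   under refinement and its limit over a net is its infimum. Since [P] and [Q]
   both refine [P `|` Q], on which the supremum is the larger of those on [P] and
   on [Q], the infimum over the sum net vanishes exactly when both infima do. *)
Require Import Defs.
From HB Require Import structures.
From mathcomp Require Import all_boot all_order all_algebra.
From mathcomp Require Import complex.
From mathcomp Require Import all_classical all_reals all_analysis.

Local Open Scope classical_set_scope.
Local Open Scope ring_scope.

Set Implicit Arguments.
Unset Strict Implicit.

Import Order.TTheory GRing.Theory Num.Theory.
Import numFieldNormedType.Exports.

Section Operators.
Context {R : realType} {H : completeNormedModType R[i]}.
Implicit Types (x y : H) (X A B C E K : H -> H).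

(** * Real-valued norm and bounded operators *)

Lemma hnorm_ge0 x : 0 <= hnorm x.
Proof. by have := normr_ge0 x; rewrite lecE => /andP[]. Qed.

Lemma le_hnorm x y : `|x| <= `|y| -> hnorm x <= hnorm y.
Proof. by rewrite lecE => /andP[]. Qed.

Lemma hnorm0 : hnorm (0 : H) = 0.
Proof. by rewrite /hnorm normr0. Qed.

Lemma ler_hnormB x y : hnorm (x - y) <= hnorm x + hnorm y.
Proof.
by have := ler_normB x y; rewrite lecE => /andP[_]; rewrite raddfD.
Qed.

Lemma linear_funB A x y : linear A -> A (x - y) = A x - A y.
Proof.
by move=> lA; rewrite addrC -scaleN1r lA scaleN1r [LHS]addrC.
Qed.

Lemma bounded_op0 : bounded_op (fun _ : H => 0 : H).
Proof.
split; first by move=> a x y; rewrite scaler0 addr0.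
by exists 0 => x; rewrite hnorm0 mul0r.
Qed.

Lemma bounded_opB A B : bounded_op A -> bounded_op B -> bounded_op (A \- B).
Proof.
move=> [lA [MA bA]] [lB [MB bB]]; split.
  by move=> a x y /=; rewrite lA lB scalerBr opprD addrACA.
exists (MA + MB) => x; rewrite mulrDl.
exact: le_trans (ler_hnormB _ _) (lerD (bA x) (bB x)).
Qed.

(** The constant in [bounded_op] carries no sign; its absolute value is also a bound, and can
    multiply inequalities. *)
Lemma bounded_op_ge0 A : bounded_op A ->
  exists2 M : R, 0 <= M & forall x, hnorm (A x) <= M * hnorm x.
Proof.
move=> [_ [M bA]]; exists `|M| => // x; apply: le_trans (bA x) _.
by rewrite ler_wpM2r ?hnorm_ge0 ?ler_norm.
Qed.

Lemma bounded_op_comp A B : bounded_op A -> bounded_op B -> bounded_op (A \o B).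
Proof.
move=> bA bB; have [M M0 hM] := bounded_op_ge0 bA.
have [[lA _] [lB [MB hMB]]] := (bA, bB).
split; first by move=> a x y /=; rewrite lB lA.
exists (M * MB) => x /=; apply: le_trans (hM _) _.
by rewrite -mulrA ler_wpM2l.
Qed.

(** * Operator norm, compact operators and essential norm *)

Lemma hnorm_le_opnorm A x : bounded_op A -> hnorm x <= 1 -> hnorm (A x) <= opnorm A.
Proof.
move=> bA x1; apply: ub_le_sup; last by exists x.
(* Boundedness of [A] makes the set under [sup] bounded above, so that [sup] is a true supremum. *)
have [M M0 hM] := bounded_op_ge0 bA.
exists M => _ [y /= y1 <-]; apply: le_trans (hM y) _.
by rewrite -[leRHS]mulr1 ler_wpM2l.
Qed.

Lemma opnorm_le A (c : R) :
  (forall x, hnorm x <= 1 -> hnorm (A x) <= c) -> opnorm A <= c.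
Proof.
move=> Ac; apply: ge_sup; last by move=> _ [x /= x1 <-]; exact: Ac.
by exists (hnorm (A 0)), 0; rewrite //= hnorm0.
Qed.

Lemma opnorm_ge0 A : bounded_op A -> 0 <= opnorm A.
Proof.
move=> bA; apply: le_trans (hnorm_ge0 (A 0)) _.
by apply: hnorm_le_opnorm; rewrite // hnorm0.
Qed.

(** The image of the unit ball lies in the compact set [[set 0]], which is closed because a normed
    space is Hausdorff. This makes the infimum in [ess_norm] range over a nonempty set. *)
Lemma compact_op0 : compact_op (fun _ : H => 0 : H).
Proof.
split; first exact: bounded_op0.
apply: (@subclosed_compact _ _ [set 0]); first exact: closed_closure.
  exact: compact_set1.
(* Write the closed set on the right as its own closure, so that monotonicity of closure applies. *)
rewrite [X in _ `<=` X](iffLR (closure_id _)); last first.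
  apply: compact_closed; [exact: norm_hausdorff|exact: compact_set1].
by apply: closureS => _ [x _ <-].
Qed.

Let ess_set X := [set opnorm (X \- K) | K in @compact_op R H].

Lemma ess_set_lbound0 X : bounded_op X -> lbound (ess_set X) 0.
Proof. by move=> bX _ [K [bK _] <-]; exact: opnorm_ge0 (bounded_opB bX bK). Qed.

Lemma ess_set_neq0 X : ess_set X !=set0.
Proof. by exists (opnorm (X \- (fun=> 0))), (fun=> 0) => //; exact: compact_op0. Qed.

Lemma ess_norm_ge0 X : bounded_op X -> 0 <= ess_norm X.
Proof. by move=> bX; apply: lb_le_inf (ess_set_neq0 X) (ess_set_lbound0 bX). Qed.

Lemma ess_norm_le X K :
  bounded_op X -> compact_op K -> ess_norm X <= opnorm (X \- K).
Proof.
move=> bX cK; apply: ge_inf; last by exists K.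
by exists 0; exact: ess_set_lbound0.
Qed.

Lemma ess_norm_le_opnorm X : bounded_op X -> ess_norm X <= opnorm X.
Proof.
move=> bX; rewrite [X in opnorm X](_ : _ = X \- (fun=> 0)).
  exact: ess_norm_le bX compact_op0.
by apply/funext => x /=; rewrite subr0.
Qed.

(** * Compression by linear contractions *)

Lemma contraction_continuous E :
  linear E -> (forall x, `|E x| <= `|x|) -> continuous E.
Proof.
move=> lE cE x; apply/cvgrPdist_lt => e e0; near=> y.
rewrite -(linear_funB _ _ lE); apply: le_lt_trans (cE _) _.
by near: y; apply: cvgr_dist_lt e0.
Unshelve. all: by end_near. Qed.

Lemma contraction_bounded E :
  linear E -> (forall x, `|E x| <= `|x|) -> bounded_op E.
Proof. by move=> lE cE; split=> //; exists 1 => x; rewrite mul1r le_hnorm. Qed.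

(** As [E] maps the unit ball into itself, the image of the ball under [E \o K \o E] lies in [E @]
    closure (K @[B)], a continuous image of a compact set, hence compact and closed. *)
Lemma compact_op_sandwich E K : linear E -> (forall x, `|E x| <= `|x|) ->
  compact_op K -> compact_op (E \o K \o E).
Proof.
move=> lE cE [bK cK]; have bE := contraction_bounded lE cE.
split; first exact: bounded_op_comp (bounded_op_comp bE bK) bE.
set B := [set x : H | hnorm x <= 1].
have cEK : compact (E @` closure (K @` B)).
  apply: continuous_compact cK; apply: continuous_subspaceT.
  exact: contraction_continuous.
apply: (subclosed_compact (@closed_closure _ _) cEK).
rewrite [X in _ `<=` X](iffLR (closure_id _)); last first.
  by apply: compact_closed; [exact: norm_hausdorff|exact: cEK].
apply: closureS => _ [x Bx <-] /=; exists (K (E x)) => //.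
apply: subset_closure; exists (E x) => //.
exact: le_trans (le_hnorm (cE x)) Bx.
Qed.

(** For compact [K], the operator [E K E] is a compact approximant of [E X E], and
    [E X E - E K E = E (X - K) E] has norm at most that of [X - K]. Take the infimum over [K]. *)
Lemma ess_norm_sandwich E X : linear E -> (forall x, `|E x| <= `|x|) ->
  bounded_op X -> ess_norm (E \o X \o E) <= ess_norm X.
Proof.
move=> lE cE bX; have bE := contraction_bounded lE cE.
apply: lb_le_inf (ess_set_neq0 X) _ => _ [K cK <-].
have bEXE := bounded_op_comp (bounded_op_comp bE bX) bE.
apply: le_trans (ess_norm_le bEXE (compact_op_sandwich lE cE cK)) _.
apply: opnorm_le => x x1 /=; rewrite -(linear_funB _ _ lE).
apply: le_trans (le_hnorm (cE _)) _.
apply: (@hnorm_le_opnorm (X \- K)); first exact: bounded_opB bX (proj1 cK).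
exact: le_trans (le_hnorm (cE x)) x1.
Qed.

End Operators.

Section Nests.
Context {R : realType} {H : completeNormedModType R[i]}.
Context {ip : {dot H for Num.conj}} (ip_norm : induces_norm ip).
Context {N : set (H -> H)} (nestN : is_nest ip N).
Implicit Types (X E F L M : H -> H) (P Q : set (H -> H)).
Implicit Types (Omega Psi : set (set (H -> H))).

(** * Orthogonal projections and intervals of the nest *)

Lemma orth_proj_ip E x : orth_proj ip E -> ip (E x) x = `|E x| ^+ 2.
Proof.
move=> [_ EE sE]; rewrite -ip_norm -[E in LHS]EE /=; exact: sE.
Qed.

Lemma orth_proj_contraction E x : orth_proj ip E -> `|E x| <= `|x|.
Proof.
move=> pE; rewrite -ler_sqr ?nnegrE ?normr_ge0//.
have xEE : ip x (E x) = `|E x| ^+ 2.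
  by case: (pE) => _ _ <-; exact: orth_proj_ip.
(* Expanding the inner product turns [|x - E x|^2] into [|x|^2 - |E x|^2]. *)
have := exprn_ge0 2 (normr_ge0 (x - E x)).
rewrite -ip_norm linearBl !linearBr /= xEE (orth_proj_ip _ pE) !ip_norm.
by rewrite subrr subr0 subr_ge0.
Qed.

(* [F x = 0] forces [|E x|^2 = <E x, x> <= <F x, x> = 0]; apply this to
   [x - F x], then take adjoints. *)
Lemma op_le_orth_proj E F : orth_proj ip E -> orth_proj ip F ->
  op_le ip E F -> E \o F = E /\ F \o E = E.
Proof.
move=> pE pF EF; have [[lE _] _ sE] := pE; have [[lF _] FF sF] := pF.
have EFE : forall x, E (F x) = E x.
  move=> x; apply/esym/eqP; rewrite -subr_eq0 -(linear_funB _ _ lE) -normr_eq0.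
  have FFx : F (F x) = F x by rewrite -[in RHS]FF.
  have := EF (x - F x); rewrite (orth_proj_ip _ pE) (orth_proj_ip _ pF).
  rewrite (linear_funB _ _ lF) FFx subrr normr0 expr0n /=.
  by rewrite -sqrf_eq0 eq_le exprn_ge0 // andbT.
split; first exact/funext.
apply/funext => x /=.
have ipB0 : forall y, ip (F (E x) - E x) y = 0.
  by move=> y; rewrite linearBl /= sF sE EFE -sE subrr.
apply/eqP; rewrite -subr_eq0 -normr_eq0 -sqrf_eq0 -ip_norm; exact/eqP.
Qed.

(** From [M <= L] follows [L M = M L = M], whence [(L - M)^2 = L - M - M + M = L - M]. *)
Lemma interval_orth_proj E : Defs.interval ip N E -> orth_proj ip E.
Proof.
case: nestN => projN _ _ _ _ [M [L [/projN pM /projN pL ML ->]]].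
have [MoL LoM] := op_le_orth_proj pM pL ML.
case: pM => bM MM sM; case: pL => bL LL sL; split.
- exact: bounded_opB.
- apply/funext => x /=.
  rewrite (linear_funB _ _ (proj1 bL)) (linear_funB _ _ (proj1 bM)).
  have LLx : L (L x) = L x by rewrite -[in RHS]LL.
  have MMx : M (M x) = M x by rewrite -[in RHS]MM.
  have MLx : M (L x) = M x by rewrite -[in RHS]MoL.
  have LMx : L (M x) = M x by rewrite -[in RHS]LoM.
  by rewrite LLx MMx MLx LMx subrr subr0.
- by move=> x y /=; rewrite linearBl linearBr /= sL sM.
Qed.

(** * Essential norms of compressions and their suprema over families *)

Lemma bounded_op_compress X E :
  bounded_op X -> Defs.interval ip N E -> bounded_op (E \o X \o E).
Proof.
move=> bX /interval_orth_proj[bE _ _].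
exact: bounded_op_comp (bounded_op_comp bE bX) bE.
Qed.

Lemma ess_norm_compress_le X E F : bounded_op X ->
  Defs.interval ip N E -> Defs.interval ip N F -> op_le ip E F ->
  ess_norm (E \o X \o E) <= ess_norm (F \o X \o F).
Proof.
move=> bX iE iF EF; have pE := interval_orth_proj iE.
have [EoF FoE] := op_le_orth_proj pE (interval_orth_proj iF) EF.
rewrite (_ : E \o X \o E = E \o (F \o X \o F) \o E).
  apply: ess_norm_sandwich; first by case: pE => -[].
    by move=> x; exact: orth_proj_contraction.
  exact: bounded_op_compress.
by rewrite -{1}EoF -{2}FoE.
Qed.

Lemma ess_norm_le_sup_ess X P E : bounded_op X -> P `<=` Defs.interval ip N ->
  P E -> ess_norm (E \o X \o E) <= sup_ess X P.
Proof.
move=> bX iP PE; apply: ub_le_sup; last by exists E.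
(* Each compression has essential norm at most that of [X], hence at most [opnorm X]; the set under
   [sup] is therefore bounded above. *)
exists (opnorm X) => _ [F /iP iF <-].
have [[lF _] _ _] := interval_orth_proj iF.
apply: le_trans (ess_norm_le_opnorm bX); apply: ess_norm_sandwich => // x.
exact: orth_proj_contraction (interval_orth_proj iF).
Qed.

Lemma sup_ess_ge0 X P : bounded_op X -> P `<=` Defs.interval ip N -> 0 <= sup_ess X P.
Proof.
move=> bX iP; have [->|/set0P[E PE]] := eqVneq P set0.
  by rewrite /sup_ess image_set0 sup0.
apply: le_trans (ess_norm_le_sup_ess bX iP PE).
exact: ess_norm_ge0 (bounded_op_compress bX (iP _ PE)).
Qed.

(** The assumption [0 <= c] covers the empty family, on which [sup_ess] is 0. *)
Lemma sup_ess_le X P (c : R) : 0 <= c ->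
  (forall E, P E -> ess_norm (E \o X \o E) <= c) -> sup_ess X P <= c.
Proof.
move=> c0 Pc; have [->|/set0P[E PE]] := eqVneq P set0.
  by rewrite /sup_ess image_set0 sup0.
apply: ge_sup; last by move=> _ [F PF <-]; exact: Pc.
by exists (ess_norm (E \o X \o E)), E.
Qed.

Lemma refines_sub P Q : P `<=` Q -> refines ip P Q.
Proof. by move=> PQ E /PQ QE; exists E => // x. Qed.

Lemma sup_ess_refines X P Q : bounded_op X ->
  P `<=` Defs.interval ip N -> Q `<=` Defs.interval ip N ->
  refines ip P Q -> sup_ess X P <= sup_ess X Q.
Proof.
move=> bX iP iQ PQ; apply: sup_ess_le; first exact: sup_ess_ge0.
move=> E PE; have [F QF EF] := PQ _ PE.
apply: le_trans (ess_norm_le_sup_ess bX iQ QF).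
by apply: ess_norm_compress_le => //; [exact: iP|exact: iQ].
Qed.

(** * Limits along a net of intervals *)

Lemma net_filter_filter Omega :
  interval_net ip N Omega -> Filter (net_filter ip Omega).
Proof.
move=> [[P0 OP0] _ dirO]; apply: filter_from_filter; first by exists P0.
move=> P1 P2 OP1 OP2; have [P [OP PP1 PP2]] := dirO _ _ OP1 OP2.
(* By transitivity, every refinement of [P] refines both [P1] and [P2]. *)
have trans Q P' : refines ip Q P -> refines ip P P' -> refines ip Q P'.
  move=> QP PP' E /QP[F /PP'[G P'G FG] EF].
  by exists G => // x; exact: le_trans (EF x) (FG x).
by exists P => // Q [OQ QP]; split; split=> //; exact: trans QP _.
Qed.

(** A nonnegative function that decreases under refinement tends to 0 exactly when it takes
    arbitrarily small values: once small at [P], it stays small at all refinements of [P]. *)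
Lemma net_kernelP Omega X : interval_net ip N Omega ->
  net_kernel ip N Omega X <->
  nest_alg N X /\ forall e : R, 0 < e -> exists2 P, Omega P & sup_ess X P < e.
Proof.
move=> netO; have FO := net_filter_filter netO; have [_ iO _] := netO.
split=> -[aX hX]; split=> //; have [bX _] := aX.
- move=> e e0; have /cvgr0Pnorm_lt/(_ e e0)[P OP hP] := hX.
  (* [P] refines itself, so the eventual bound holds at [P]. *)
  exists P => //; apply: le_lt_trans (ler_norm _) (hP P _).
  by split=> //; exact: refines_sub.
- apply/cvgr0Pnorm_lt => e /hX[P OP Pe]; exists P => // Q [OQ QP] /=.
  rewrite ger0_norm; last by apply: sup_ess_ge0 => //; exact: iO.
  by apply: le_lt_trans Pe; apply: sup_ess_refines => //; exact: iO.
Qed.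

(** * The sum of two nets and its kernel *)

Lemma interval_net_add Omega Psi :
  interval_net ip N Omega -> interval_net ip N Psi ->
  interval_net ip N (net_add Omega Psi).
Proof.
move=> [[P0 OP0] iO dO] [[Q0 PQ0] iP dP]; split.
- by exists (P0 `|` Q0), P0 => //; exists Q0.
- by move=> _ [P OP [Q PQ <-]]; rewrite subUset; split; [exact: iO|exact: iP].
- move=> _ _ [P1 OP1 [Q1 PQ1 <-]] [P2 OP2 [Q2 PQ2 <-]].
  (* Common refinements are chosen separately in each net; their union refines both given unions. *)
  have [P [OP PP1 PP2]] := dO _ _ OP1 OP2.
  have [Q [PQ QQ1 QQ2]] := dP _ _ PQ1 PQ2.
  exists (P `|` Q); split; first by exists P => //; exists Q.
  + by move=> E [/PP1|/QQ1][F ? ?]; exists F => //; [left|right].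
  + by move=> E [/PP2|/QQ2][F ? ?]; exists F => //; [left|right].
Qed.

(** The family enters [iso_image] only through membership of [L \- M], which splits over a union;
    stability of the sum net rests on this. *)
Lemma iso_imageU theta P Q :
  iso_image ip N theta (P `|` Q) =
  iso_image ip N theta P `|` iso_image ip N theta Q.
Proof.
apply/seteqP; split=> E.
- by move=> [M [L [NM NL ML [?|?] ->]]]; [left|right]; exists M, L.
- by move=> [|][M [L [NM NL ML ? ->]]]; exists M, L; split=> //; [left|right].
Qed.

Lemma stable_net_add Omega Psi :
  stable_net ip N Omega -> stable_net ip N Psi ->
  stable_net ip N (net_add Omega Psi).
Proof.
move=> [netO stO] [netP stP]; split; first exact: interval_net_add.
move=> theta _ iso [P OP [Q PQ <-]]; rewrite iso_imageU.
exists (iso_image ip N theta P); first exact: stO.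
by exists (iso_image ip N theta Q) => //; exact: stP.
Qed.

Lemma net_kernel_add Omega Psi :
  interval_net ip N Omega -> interval_net ip N Psi ->
  net_kernel ip N Omega `&` net_kernel ip N Psi =
  net_kernel ip N (net_add Omega Psi).
Proof.
move=> netO netP; have netOP := interval_net_add netO netP.
have [[_ iO _] [_ iP _]] := (netO, netP).
apply/seteqP; split=> X.
- move=> [/(net_kernelP X netO)[aX hO] /(net_kernelP X netP)[_ hP]].
  have [bX _] := aX; apply/(net_kernelP X netOP); split=> // e e0.
  have [P OP Pe] := hO _ e0; have [Q PQ Qe] := hP _ e0.
  exists (P `|` Q); first by exists P => //; exists Q.
  apply: (@le_lt_trans _ _ (Num.max (sup_ess X P) (sup_ess X Q))).
    (* The maximum must be nonnegative for the case where both families are empty. *)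
    apply: sup_ess_le; first by rewrite le_max (sup_ess_ge0 bX (iO _ OP)).
    move=> E [PE|QE]; rewrite le_max.
      by rewrite (ess_norm_le_sup_ess bX (iO _ OP) PE).
    by rewrite (ess_norm_le_sup_ess bX (iP _ PQ) QE) orbT.
  by rewrite gt_max Pe Qe.
- move=> /(net_kernelP X netOP)[aX hX]; have [bX _] := aX.
  (* A union with small supremum has both of its parts as refinements; monotonicity passes the bound
     to each part. *)
  split; [apply/(net_kernelP X netO)|apply/(net_kernelP X netP)];
    split=> // e /hX[_ [P OP [Q PQ <-]] PQe]; have iPQ : P `|` Q `<=` Defs.interval ip N
      by rewrite subUset; split; [exact: iO|exact: iP].
  + exists P => //; apply: le_lt_trans PQe; apply: sup_ess_refines => //.
      exact: iO.
    by apply: refines_sub => E; left.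
  + exists Q => //; apply: le_lt_trans PQe; apply: sup_ess_refines => //.
      exact: iP.
    by apply: refines_sub => E; right.
Qed.

End Nests.

Theorem proposition3p12 (R : realType) (H : completeNormedModType R[i])
    (ip : {dot H for Num.conj}) (ip_norm : induces_norm ip)
    (H_sep : separable_space H)
    (N : set (H -> H)) (N_cont : continuous_nest ip N)
    (Omega Psi : set (set (H -> H)))
    (Omega_stable : stable_net ip N Omega)
    (Psi_stable : stable_net ip N Psi) :
  stable_net ip N (net_add Omega Psi) /\
  net_kernel ip N Omega `&` net_kernel ip N Psi =
    net_kernel ip N (net_add Omega Psi).
Proof.
split; first exact: stable_net_add.
have [nestN _] := N_cont.
exact (net_kernel_add ip_norm nestN (proj1 Omega_stable) (proj1 Psi_stable)).
Qed.
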